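(* Let $X^0,X^1:[t_0,t_1]\times[0,1]\to\mathbb R^n$ be two smooth moving closed curves with the same initial value, $X^0(t_0,p)=X^1(t_0,p)$ for all $p\in[0,1]$, where $X^1$ is a solution of Curve Shortening and $X^0$ is an arbitrary moving curve. Assume that for each $\epsilon\in[t_0,t_1]$ there is a smooth solution $(t,p)\mapsto X(\epsilon,t,p)$ of Curve Shortening, defined for $t\in[\epsilon,t_1]$, with initial value $X(\epsilon,\epsilon,p)=X^0(\epsilon,p)$, and that the family is parametrized so that $X_\epsilon\perp X_p$ pointwise. Then \[ \int_{\epsilon=t_0}^{t_1}\int_{p=0}^1\|\partial_\epsilon X(\epsilon,t_1,p)\|\,ds\,d\epsilon\;\leqslant\;\Delta,\qquad \Delta:=\int_{t_0}^{t_1}\int_{p=0}^1\bigl\|(\partial_tX^0)^\perp-\partial_s^2X^0\bigr\|\,ds\,dt . \]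
   Context: Moving curves are smooth with $X_p\ne0$, and closed curves means that everything is $1$-periodic in $p$. Arclength notation: $ds=\|X_p\|\,dp$, $\partial_s=\|X_p\|^{-1}\partial_p$ (computed for the curve being integrated over). $(\cdot)^\perp$ is the component orthogonal to $X_s$. A moving curve $X(t,p)$ is a solution of Curve Shortening if $X_t=X_{ss}+\lambda X_s$ for some smooth function $\lambda(t,p)$ (tangential motion allowed). The family $X(\epsilon,t,p)$ is smooth in $(\epsilon,t,p)$ on $\{t_0\leqslant\epsilon\leqslant t\leqslant t_1,\ p\in[0,1]\}$. *)

(* Defs.v *)
From HB Require Import structures.
From mathcomp Require Import all_boot all_order all_algebra.
From mathcomp Require Import all_classical all_reals all_analysis.

Set Implicit Arguments.
Unset Strict Implicit.
Unset Printing Implicit Defensive.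

Import Order.TTheory GRing.Theory Num.Theory.
Import numFieldNormedType.Exports.

Local Open Scope classical_set_scope.
Local Open Scope ring_scope.

(* [iter_derive [:: v1; ...; vk] f] is the iterated directional derivative
   D_v1 (... (D_vk f)). *)
Definition iter_derive (R : realType) (V W : normedModType R)
    (vs : seq V) (f : V -> W) : V -> W :=
  foldr (fun v g => fun x => 'D_v g x) f vs.

(* Smoothness on a set [A] that need not be open (below, [A] is a closed strip
   or a closed prism): [f] is C^infinity on some open neighbourhood of [A].
   When [A] is the closure of its interior, the derivatives of [f] at the points
   of [A], all orders included, depend only on the values of [f] on [A]. *)
Definition smooth_on (R : realType) (V W : normedModType R)
    (A : set V) (f : V -> W) : Prop :=
  exists U : set V, [/\ open U, A `<=` U &
    forall (vs : seq V) (x : V), U x -> differentiable (iter_derive vs f) x].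

(* The library norm on ['rV[R]_n] is the sup norm, used here only for its
   topology; the geometry uses the Euclidean structure below. *)
Definition dot (R : realType) (n : nat) (u v : 'rV[R]_n) : R :=
  \sum_(i < n) u 0 i * v 0 i.

Definition enorm (R : realType) (n : nat) (u : 'rV[R]_n) : R :=
  Num.sqrt (dot u u).

(* A closed curve is a map [c : R -> 'rV[R]_n] that is periodic of period 1;
   the parameter interval [0, 1] is one period. *)
Definition speed (R : realType) (n : nat) (c : R -> 'rV[R]_n) (p : R) : R :=
  enorm (derive1 c p).

(* d/ds = |c_p|^-1 d/dp, applied to a vector field [f] along the curve [c];
   in particular [dds c c] is the unit tangent c_s and [dds c (dds c c)] the
   curvature vector c_ss. *)
Definition dds (R : realType) (n : nat) (c f : R -> 'rV[R]_n)
    : R -> 'rV[R]_n :=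
  fun p => (speed c p)^-1 *: derive1 f p.

(* Component of [v] orthogonal to c_s, a unit vector where c_p <> 0. *)
Definition normal_part (R : realType) (n : nat) (c : R -> 'rV[R]_n) (p : R)
    (v : 'rV[R]_n) : 'rV[R]_n :=
  v - dot v (dds c c p) *: dds c c p.

(* Integral of [g] over one period of [c] with respect to ds = |c_p| dp. It is
   only used for g >= 0, where the extended-real integral is the true one. *)
Definition arclength_integral (R : realType) (n : nat) (c : R -> 'rV[R]_n)
    (g : R -> R) : \bar R :=
  (\int[lebesgue_measure]_(p in `[0%R, 1%R]) (g p * speed c p)%:E)%E.

(* Time-first convention: [X t] is the curve at time [t]. The parameter [p]
   ranges over the whole line. *)
Definition strip (R : realType) (a b : R) : set (R * R) :=
  [set tp | a <= tp.1 <= b].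

Definition periodic1 (R : realType) (T : Type) (a b : R) (f : R -> R -> T) :=
  forall t p : R, a <= t <= b -> f t (p + 1) = f t p.

Definition moving_closed_curve (R : realType) (n : nat) (a b : R)
    (X : R -> R -> 'rV[R]_n) : Prop :=
  [/\ smooth_on (strip a b) (fun tp : R * R => X tp.1 tp.2),
      periodic1 a b X &
      forall t p : R, a <= t <= b -> derive1 (X t) p != 0].

Definition curve_shortening_solution (R : realType) (n : nat) (a b : R)
    (X : R -> R -> 'rV[R]_n) : Prop :=
  moving_closed_curve a b X /\
  exists lambda : R -> R -> R,
    [/\ smooth_on (strip a b) (fun tp : R * R => lambda tp.1 tp.2),
        periodic1 a b lambda &
        forall t p : R, a <= t <= b ->
          derive1 (X ^~ p) t
            = dds (X t) (dds (X t) (X t)) p + lambda t p *: dds (X t) (X t) p].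

(* Points ((epsilon, t), p) with a <= epsilon <= t <= b. *)
Definition prism (R : realType) (a b : R) : set (R * R * R) :=
  [set z | a <= z.1.1 /\ z.1.1 <= z.1.2 /\ z.1.2 <= b].

(* Main.v *)
(** Fix [eps], write [Y = X_eps], [v = |X_p|] and let [t] vary. Curve shortening
    reads [X_t = X_pp / v^2 + mu X_p] with some function [mu]. For [d > 0] and
    [F = sqrt (|Y|^2 + d)], which stays smooth at the zeros of [Y], one has
      (F v)_t <= H_p   with   H = (<Y, Y_p> / F + <X_t, X_p> F) / v,
    because in [H_p - (F v)_t] all third order terms cancel and what remains is
    nonnegative by two Gram determinant inequalities for vectors orthogonal to
    [X_p]. As [H] is periodic, the integral of [F v] over a period does not
    increase in [t]; letting [d] tend to 0, neither does the integral of [|Y| v].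
    On the diagonal [t = eps], differentiating [X(eps, eps, p) = X0(eps, p)]
    identifies [Y] with the normal part of [X0_t] minus the curvature vector of
    [X0]. It remains to integrate over [eps]. *)

Require Import Defs.
From HB Require Import structures.
From mathcomp Require Import all_boot all_order all_algebra.
From mathcomp Require Import all_classical all_reals all_analysis.
From mathcomp Require Import ring.

Set Implicit Arguments.
Unset Strict Implicit.
Unset Printing Implicit Defensive.

Import Order.TTheory GRing.Theory Num.Theory.
Import numFieldNormedType.Exports.

Local Open Scope classical_set_scope.
Local Open Scope ring_scope.

(** * Monotonicity of nonnegative integrals, and Euclidean algebra *)

(** The integral of a nonnegative function is a supremum over the simple functions below it, and a
    larger integrand admits more of them. This form lets the inner integrals be compared for each
    [eps] separately, with no measurability in [eps] to establish. *)
Lemma ge0_le_integral_nonmeasurable d (T : measurableType d) (R : realType)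
    (mu : {measure set T -> \bar R}) (D : set T) (f g : T -> \bar R) :
  (forall x, D x -> (0 <= f x)%E) -> (forall x, D x -> (f x <= g x)%E) ->
  (\int[mu]_(x in D) f x <= \int[mu]_(x in D) g x)%E.
Proof.
move=> f0 fg; rewrite !ge0_integralE//; last first.
  by move=> x Dx; apply: le_trans (fg _ Dx); exact: f0.
apply: ereal_sup_le => _ [h hf <-]; exists h => // x.
by rewrite (le_trans (hf x))// lee_restrict.
Qed.

Lemma dotC (R : realType) n (u v : 'rV[R]_n) : dot u v = dot v u.
Proof. by apply: eq_bigr => i _; rewrite mulrC. Qed.

Lemma dotDl (R : realType) n (u v w : 'rV[R]_n) :
  dot (u + v) w = dot u w + dot v w.
Proof. by rewrite /dot -big_split; apply: eq_bigr => i _; rewrite mxE mulrDl. Qed.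

Lemma dotZl (R : realType) n k (u v : 'rV[R]_n) : dot (k *: u) v = k * dot u v.
Proof. by rewrite /dot mulr_sumr; apply: eq_bigr => i _; rewrite mxE mulrA. Qed.

Lemma dotDr (R : realType) n (u v w : 'rV[R]_n) :
  dot u (v + w) = dot u v + dot u w.
Proof. by rewrite !(dotC u) dotDl. Qed.

Lemma dotZr (R : realType) n k (u v : 'rV[R]_n) : dot u (k *: v) = k * dot u v.
Proof. by rewrite !(dotC u) dotZl. Qed.

Lemma dotNl (R : realType) n (u v : 'rV[R]_n) : dot (- u) v = - dot u v.
Proof. by rewrite -scaleN1r dotZl mulN1r. Qed.

Lemma dotNr (R : realType) n (u v : 'rV[R]_n) : dot u (- v) = - dot u v.
Proof. by rewrite !(dotC u) dotNl. Qed.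

Lemma dot0l (R : realType) n (u : 'rV[R]_n) : dot 0 u = 0.
Proof. by rewrite -(scale0r 0) dotZl mul0r. Qed.

Lemma dot_ge0 (R : realType) n (u : 'rV[R]_n) : 0 <= dot u u.
Proof. by apply: sumr_ge0 => i _; rewrite -expr2 sqr_ge0. Qed.

Lemma dot_gt0 (R : realType) n (u : 'rV[R]_n) : (0 < dot u u) = (u != 0).
Proof.
rewrite lt_def dot_ge0 andbT; apply/idP/idP; apply: contraNN.
  by move=> /eqP ->; rewrite dot0l.
rewrite /dot psumr_eq0 => [/allP u0|i _]; last by rewrite -expr2 sqr_ge0.
apply/eqP/rowP => i; have := u0 i (mem_index_enum i).
by rewrite /= mulf_eq0 orbb mxE => /eqP.
Qed.

(** For [u != 0] the squared length of [|u|^2 v - <u,v> u] is [|u|^2] times the difference of the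
    two sides. *)
Lemma dot_cauchy_schwarz (R : realType) n (u v : 'rV[R]_n) :
  dot u v ^+ 2 <= dot u u * dot v v.
Proof.
have [->|] := eqVneq u 0; first by rewrite !dot0l expr2 !mul0r.
rewrite -dot_gt0 => u0.
have := dot_ge0 (dot u u *: v - dot u v *: u).
rewrite !(dotDl, dotDr, dotNl, dotNr, dotZl, dotZr) (dotC v u) => h.
rewrite -(ler_pM2l u0) -subr_ge0; apply: le_trans h _.
by rewrite le_eqVlt; apply/orP; left; apply/eqP; ring.
Qed.

(* Nonnegativity of the Gram determinant of [a], [y], [w]. *)
Lemma dot_gram (R : realType) n (a y w : 'rV[R]_n) : dot y a = 0 ->
  dot a a * dot y w ^+ 2 <= dot y y * (dot a a * dot w w - dot a w ^+ 2).
Proof.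
have [->|] := eqVneq a 0; first by rewrite !dot0l expr0n /= !(mul0r, subrr, mulr0).
rewrite -dot_gt0 => a0 ya.
(* The second vector is [|a|^2] times the component of [w] orthogonal to [a]; since [y] is
   orthogonal to [a], its product with [y] is [|a|^2 <y,w>]. One common factor [|a|^2] cancels in
   the end. *)
have := dot_cauchy_schwarz y (dot a a *: w - dot a w *: a).
rewrite !(dotDl, dotDr, dotNl, dotNr, dotZl, dotZr) ya (dotC w a) => h.
rewrite -(ler_pM2l a0) -subr_ge0.
rewrite -subr_ge0 in h; apply: le_trans h _.
by rewrite le_eqVlt; apply/orP; left; apply/eqP; ring.
Qed.

(** * Directional and one-sided derivatives *)

Lemma is_derive_rowP (R : realType) (V : normedModType R) n
    (f : V -> 'rV[R]_n) x v df :
  is_derive x v f df <-> forall i, is_derive x v (fun y => f y 0 i) (df 0 i).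
Proof.
split=> [fd i|fd].
  have /derivable_mxP/(_ 0 i) fi := @ex_derive _ _ _ _ _ _ _ fd.
  by apply: DeriveDef => //; rewrite -(@derive_val _ _ _ _ _ _ _ fd) derive_mx ?mxE//.
have fv : derivable f x v.
  by apply/derivable_mxP => i j; rewrite ord1; exact: (@ex_derive _ _ _ _ _ _ _ (fd j)).
apply: DeriveDef => //; rewrite derive_mx//; apply/rowP => i; rewrite mxE.
exact: (@derive_val _ _ _ _ _ _ _ (fd i)).
Qed.

Lemma is_derive_mul (R : realType) (V : normedModType R) (f g : V -> R) x v df dg :
  is_derive x v f df -> is_derive x v g dg ->
  is_derive x v (fun y => f y * g y) (df * g x + f x * dg).
Proof.
move=> fd gd; have := is_deriveM fd gd; rewrite addrC => h.
by rewrite [X in X + _]mulrC.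
Qed.

Lemma is_derive_dot (R : realType) (V : normedModType R) n
    (f g : V -> 'rV[R]_n) x v df dg :
  is_derive x v f df -> is_derive x v g dg ->
  is_derive x v (fun y => dot (f y) (g y)) (dot df (g x) + dot (f x) dg).
Proof.
move=> /is_derive_rowP fd /is_derive_rowP gd.
have h (i : 'I_n) := is_derive_mul (fd i) (gd i).
have := is_derive_sum h; rewrite big_split /=.
by rewrite (_ : \sum_(i < n) _ = fun y => dot (f y) (g y))//; apply/funext => y; rewrite fct_sumE.
Qed.

Lemma is_derive_scale (R : realType) (V : normedModType R) n
    (k : V -> R) (f : V -> 'rV[R]_n) x v dk df :
  is_derive x v k dk -> is_derive x v f df ->
  is_derive x v (fun y => k y *: f y) (dk *: f x + k x *: df).
Proof.
move=> kd /is_derive_rowP fd; apply/is_derive_rowP => i; rewrite !mxE.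
under eq_fun do rewrite mxE.
exact: is_derive_mul.
Qed.

Lemma is_derive_sqrt (R : realType) (f : R -> R) (x df : R) : 0 < f x ->
  is_derive x 1 f df ->
  is_derive x 1 (fun y => Num.sqrt (f y)) (df / (2 * Num.sqrt (f x))).
Proof.
move=> f0 fd; rewrite mulrC.
exact: (@is_derive1_comp _ Num.sqrt f x _ _ (is_derive1_sqrt f0) fd).
Qed.

Lemma continuous_dot (R : realType) (T : topologicalType) n
    (f g : T -> 'rV[R]_n) x :
  {for x, continuous f} -> {for x, continuous g} ->
  {for x, continuous (fun y => dot (f y) (g y))}.
Proof.
move=> cf cg; apply: cvg_big => [|i _]; first exact: add_continuous.
by apply: cvgM; apply: (continuous_comp _ (@coord_continuous _ _ _ _ _ _)).
Qed.

(** A derivative that exists can be computed from the right alone. Identities known only on the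
    closed prism [eps <= t] can thus be differentiated at [eps], where only larger values, up to
    [t], are at hand. *)
Lemma derive_right_eq0 (R : realType) (V : normedModType R) (f : R -> V)
    (x r : R) df :
  is_derive x 1 f df -> 0 < r -> (forall y, x <= y <= x + r -> f y = 0) -> df = 0.
Proof.
move=> fd r0 f0; have fx : f x = 0 by rewrite f0// lexx lerDl ltW.
rewrite -(@derive_val _ _ _ _ _ _ _ fd) /derive cvg_at_rightE; last first.
  exact: (@ex_derive _ _ _ _ _ _ _ fd).
apply: lim_near_cst => //; near=> h.
rewrite fx /= subr0 f0 ?scaler0// /shift /= scaler1 lerDr addrC lerD2l.
by apply/andP; split; near: h; [exact: nbhs_right_ge|exact: nbhs_right_le].
Unshelve. all: by end_near. Qed.

Lemma derive_left_eq0 (R : realType) (V : normedModType R) (f : R -> V)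
    (x r : R) df :
  is_derive x 1 f df -> 0 < r -> (forall y, x - r <= y <= x -> f y = 0) -> df = 0.
Proof.
move=> fd r0 f0; have fx : f x = 0 by rewrite f0// lexx gerBl ltW.
rewrite -(@derive_val _ _ _ _ _ _ _ fd) /derive cvg_at_leftE; last first.
  exact: (@ex_derive _ _ _ _ _ _ _ fd).
apply: lim_near_cst => //; near=> h.
rewrite fx /= subr0 f0 ?scaler0// /shift /= scaler1 gerDr addrC lerD2r.
by apply/andP; split; near: h; [apply: nbhs_left_ge; rewrite oppr_lt0|exact: nbhs_left_le].
Unshelve. all: by end_near. Qed.

(** The hypothesis says that [l] is affine with direction [v], so the two difference quotients are
    the same function of [h], and no chain rule is involved. *)
Lemma derive1_affine (R : realType) (V W : normedModType R) (f : V -> W)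
    (l : R -> V) (v : V) s : (forall h t, l (h + t) = h *: v + l t) ->
  derive1 (fun t => f (l t)) s = 'D_v f (l s).
Proof.
by move=> lE; rewrite derive1E /derive; under eq_fun do rewrite /= /shift /= scaler1 lE.
Qed.

Lemma is_derive_affine (R : realType) (V W : normedModType R) (f : V -> W)
    (l : R -> V) (v : V) s df : (forall h t, l (h + t) = h *: v + l t) ->
  is_derive (l s) v f df -> is_derive s 1 (fun t => f (l t)) df.
Proof.
move=> lE fd; apply: DeriveDef.
  have := @ex_derive _ _ _ _ _ _ _ fd; rewrite /derivable.
  by under [in X in _ -> X]eq_fun do rewrite /= /shift /= scaler1 lE.
by rewrite -derive1E (derive1_affine _ _ lE); exact: (@derive_val _ _ _ _ _ _ _ fd).
Qed.

Lemma continuous_itv_derive (R : realType) (f df : R -> R) (a b : R) :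
  (forall x, a <= x <= b -> is_derive x 1 f (df x)) ->
  {within `[a, b], continuous f}.
Proof.
move=> fd; apply: derivable_within_continuous => x; rewrite in_itv /= => xab.
exact: (@ex_derive _ _ _ _ _ _ _ (fd x xab)).
Qed.

(** * Symmetry of second derivatives *)

(** The mean value theorem is used twice: along [v] for [phi], the increment of [f] in direction
    [w], and then along [w] for [fv]. *)
Lemma second_difference_mean_value (R : realType) (V : normedModType R)
    (f fv fvw : V -> R) (x v w : V) (h : R) : 0 < h ->
  (forall s t, 0 <= s <= h -> 0 <= t <= h ->
     is_derive (s *: v + (t *: w + x)) v f (fv (s *: v + (t *: w + x)))) ->
  (forall s t, 0 <= s <= h -> 0 <= t <= h ->
     is_derive (s *: v + (t *: w + x)) w fv (fvw (s *: v + (t *: w + x)))) ->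
  exists s t, [/\ 0 <= s <= h, 0 <= t <= h &
    f (h *: v + (h *: w + x)) - f (h *: w + x) - (f (h *: v + x) - f x)
      = fvw (s *: v + (t *: w + x)) * h * h].
Proof.
move=> h0 fd fvd; have hh : 0 <= h <= h by rewrite (ltW h0) lexx.
have h00 : 0 <= (0 : R) <= h by rewrite (ltW h0) lexx.
pose phi s := f (s *: v + (h *: w + x)) - f (s *: v + x).
have phid s : 0 <= s <= h ->
    is_derive s 1 phi (fv (s *: v + (h *: w + x)) - fv (s *: v + x)).
  move=> sh; apply: is_deriveB.
    apply: (@is_derive_affine _ _ _ f (fun s => s *: v + (h *: w + x)) v).
      by move=> k t; rewrite scalerDl -addrA.
    exact: fd.
  apply: (@is_derive_affine _ _ _ f (fun s => s *: v + x) v).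
    by move=> k t; rewrite scalerDl -addrA.
  by have := fd s 0 sh h00; rewrite scale0r add0r.
have [s /[!in_itv]/= /andP[s0 sh] phiE] := MVT h0
  (fun s sh => phid s (subset_itv_oo_cc sh)) (continuous_itv_derive phid).
have shh : 0 <= s <= h by rewrite (ltW s0) (ltW sh).
pose psi t := fv (s *: v + (t *: w + x)).
have psid t : 0 <= t <= h -> is_derive t 1 psi (fvw (s *: v + (t *: w + x))).
  move=> th; apply: (@is_derive_affine _ _ _ fv (fun t => s *: v + (t *: w + x)) w).
    by move=> k u; rewrite /= scalerDl -addrA; rewrite [LHS]addrCA.
  exact: fvd.
have [t /[!in_itv]/= /andP[t0 th] psiE] := MVT h0
  (fun t th => psid t (subset_itv_oo_cc th)) (continuous_itv_derive psid).
exists s, t; rewrite (ltW t0) (ltW th); split => //.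
move: phiE psiE; rewrite /phi /psi !scale0r !add0r !subr0 => phiE <-.
by rewrite -phiE; ring.
Qed.

(** The second difference over a parallelogram is symmetric in [v] and [w], so [fvw] and [fwv] take
    a common value at two points of a small parallelogram at [x]; continuity at [x] then forces
    equality there. *)
Lemma derive_symmetric (R : realType) (V : normedModType R)
    (f fv fw fvw fwv : V -> R) (U : set V) (x v w : V) : open U -> U x ->
  (forall y, U y -> is_derive y v f (fv y)) ->
  (forall y, U y -> is_derive y w f (fw y)) ->
  (forall y, U y -> is_derive y w fv (fvw y)) ->
  (forall y, U y -> is_derive y v fw (fwv y)) ->
  {for x, continuous fvw} -> {for x, continuous fwv} -> fvw x = fwv x.
Proof.
move=> oU Ux dv dw dvw dwv cvw cwv.
apply/eqP; rewrite -subr_eq0 -normr_eq0; apply/eqP/le_anti.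
rewrite normr_ge0 andbT; apply/ler_addgt0Pr => e e0; rewrite add0r.
have e2 : 0 < e / 2 by rewrite divr_gt0.
have nU : nbhs x U by exact: open_nbhs_nbhs.
have nvw : \forall y \near x, `|fvw x - fvw y| < e / 2.
  by move/cvgrPdist_lt : cvw; apply.
have nwv : \forall y \near x, `|fwv x - fwv y| < e / 2.
  by move/cvgrPdist_lt : cwv; apply.
have : nbhs x (U `&` ([set y | `|fvw x - fvw y| < e / 2]
                  `&` [set y | `|fwv x - fwv y| < e / 2])).
  by apply: filterI => //; exact: filterI.
move=> /nbhs_ballP[r /= r0 xr].
(* With this [h] the parallelogram has diameter below [r], so it stays in the ball; the summand 1
   keeps the denominator positive even if [v] and [w] vanish. *)
pose h := r / 2 / (`|v| + `|w| + 1).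
have vw0 : 0 < `|v| + `|w| + 1 by rewrite ltr_wpDl// addr_ge0.
have h0 : 0 < h by rewrite !divr_gt0.
have hr s t : 0 <= s <= h -> 0 <= t <= h -> ball x r (s *: v + (t *: w + x)).
  move=> /andP[s0 sh] /andP[t0 th]; rewrite -ball_normE /ball_ /=.
  rewrite addrA opprD addrCA subrr addr0 normrN.
  apply: le_lt_trans (ler_normD _ _) _; rewrite !normrZ !ger0_norm//.
  apply: (@le_lt_trans _ _ (h * (`|v| + `|w| + 1))).
    rewrite !mulrDr mulr1 -[leLHS]addr0; apply: lerD (ltW h0).
    by apply: lerD; apply: ler_wpM2r.
  by rewrite /h divfK ?gt_eqF// ltr_pdivrMr// mulr_natr mulr2n ltrDl.
have vU s t : 0 <= s <= h -> 0 <= t <= h -> U (s *: v + (t *: w + x)).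
  by move=> sh th; have [] := xr _ (hr s t sh th).
have [s [t [sh th E1]]] := @second_difference_mean_value _ _ f fv fvw x v w h h0
  (fun s t sh th => dv _ (vU s t sh th)) (fun s t sh th => dvw _ (vU s t sh th)).
have vU' s' t' : 0 <= s' <= h -> 0 <= t' <= h -> U (s' *: w + (t' *: v + x)).
  by move=> sh' th'; rewrite addrCA; exact: vU.
have [t' [s' [th' sh' E2]]] := @second_difference_mean_value _ _ f fw fwv x w v h h0
  (fun s t sh th => dw _ (vU' s t sh th)) (fun s t sh th => dwv _ (vU' s t sh th)).
have E : fvw (s *: v + (t *: w + x)) = fwv (s' *: v + (t' *: w + x)).
  rewrite (addrCA (t' *: w)) in E2.
  apply: (mulIf (lt0r_neq0 h0)); apply: (mulIf (lt0r_neq0 h0)).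
  by rewrite -E1 -E2 (addrCA (h *: w)); ring.
have [_ [nv _]] := xr _ (hr s t sh th); have [_ [_ nw]] := xr _ (hr s' t' sh' th').
rewrite [e]splitr -(subrKA (fvw (s *: v + (t *: w + x)))) [in X in _ + X]E.
apply: le_trans (ler_normD _ _) _; apply: lerD; apply: ltW => //.
by rewrite distrC.
Qed.

(** * Smooth maps on an open set and their coordinate derivatives *)

(** The condition inside [smooth_on] for one fixed neighbourhood, so that a map and all its
    derivatives are handled on the same [U]. *)
Definition smooth_in (R : realType) (V W : normedModType R) (U : set V)
    (f : V -> W) :=
  forall (vs : seq V) (x : V), U x -> differentiable (iter_derive vs f) x.

Lemma smooth_in_derive (R : realType) (V W : normedModType R) (U : set V)
    (f : V -> W) v : smooth_in U f -> smooth_in U ('D_v f).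
Proof.
by move=> sf vs x Ux; have := sf (rcons vs v) x Ux; rewrite /iter_derive foldr_rcons.
Qed.

Lemma smooth_in_is_derive (R : realType) (V W : normedModType R) (U : set V)
    (f : V -> W) v x : smooth_in U f -> U x -> is_derive x v f ('D_v f x).
Proof. by move=> sf Ux; apply/derivableP/diff_derivable; exact: (sf [::]). Qed.

Lemma smooth_in_continuous (R : realType) (V W : normedModType R) (U : set V)
    (f : V -> W) x : smooth_in U f -> U x -> {for x, continuous f}.
Proof. by move=> sf Ux; apply: differentiable_continuous; exact: (sf [::]). Qed.

Lemma smooth_in_derive_symmetric (R : realType) (V : normedModType R) n
    (U : set V) (f : V -> 'rV[R]_n) v w x : open U -> smooth_in U f -> U x ->
  'D_v ('D_w f) x = 'D_w ('D_v f) x.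
Proof.
move=> oU sf Ux; apply/rowP => i.
have d1 u y : U y -> is_derive y u (fun z => f z 0 i) ('D_u f y 0 i).
  by move=> Uy; have /is_derive_rowP := smooth_in_is_derive u sf Uy; exact.
have d2 u1 u2 y : U y ->
    is_derive y u1 (fun z => 'D_u2 f z 0 i) ('D_u1 ('D_u2 f) y 0 i).
  move=> Uy.
  by have /is_derive_rowP := smooth_in_is_derive u1 (smooth_in_derive u2 sf) Uy; exact.
have c2 u1 u2 : {for x, continuous (fun z => 'D_u1 ('D_u2 f) z 0 i)}.
  apply: (continuous_comp _ (@coord_continuous _ _ _ _ _ _)).
  exact: (smooth_in_continuous (smooth_in_derive u1 (smooth_in_derive u2 sf))).
exact: (@derive_symmetric _ _ (fun z => f z 0 i) (fun z => 'D_w f z 0 i)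
  (fun z => 'D_v f z 0 i) (fun z => 'D_v ('D_w f) z 0 i)
  (fun z => 'D_w ('D_v f) z 0 i) U x w v).
Qed.

Definition basis1 (R : realType) : R * R * R := (1, 0, 0).
Definition basis2 (R : realType) : R * R * R := (0, 1, 0).
Definition basis3 (R : realType) : R * R * R := (0, 0, 1).

Lemma line1E (R : realType) (t p h e : R) :
  (h + e, t, p) = h *: basis1 R + (e, t, p).
Proof.
rewrite (_ : _ + _ = (h *: 1 + e, h *: 0 + t, h *: 0 + p))//.
by rewrite [h *: 1]mulr1 scaler0 !add0r.
Qed.

Lemma line2E (R : realType) (e p h t : R) :
  (e, h + t, p) = h *: basis2 R + (e, t, p).
Proof.
rewrite (_ : _ + _ = (h *: 0 + e, h *: 1 + t, h *: 0 + p))//.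
by rewrite [h *: 1]mulr1 scaler0 !add0r.
Qed.

Lemma line3E (R : realType) (e t h p : R) :
  (e, t, h + p) = h *: basis3 R + (e, t, p).
Proof.
rewrite (_ : _ + _ = (h *: 0 + e, h *: 0 + t, h *: 1 + p))//.
by rewrite [h *: 1]mulr1 scaler0 !add0r.
Qed.

Lemma derive1_line1 (R : realType) (W : normedModType R) (f : R * R * R -> W)
  (e t p : R) : derive1 (fun s => f (s, t, p)) e = 'D_(basis1 R) f (e, t, p).
Proof. exact: (@derive1_affine _ _ _ f (fun s => (s, t, p)) _ _ (line1E t p)). Qed.

Lemma derive1_line2 (R : realType) (W : normedModType R) (f : R * R * R -> W)
  (e t p : R) : derive1 (fun s => f (e, s, p)) t = 'D_(basis2 R) f (e, t, p).
Proof. exact: (@derive1_affine _ _ _ f (fun s => (e, s, p)) _ _ (line2E e p)). Qed.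

Lemma derive1_line3 (R : realType) (W : normedModType R) (f : R * R * R -> W)
  (e t p : R) : derive1 (fun s => f (e, t, s)) p = 'D_(basis3 R) f (e, t, p).
Proof. exact: (@derive1_affine _ _ _ f (fun s => (e, t, s)) _ _ (line3E e t)). Qed.

Lemma smooth_in_line1 (R : realType) (W : normedModType R) (U : set (R * R * R))
    (f : R * R * R -> W) (e t p : R) : smooth_in U f -> U (e, t, p) ->
  is_derive e 1 (fun s => f (s, t, p)) ('D_(basis1 R) f (e, t, p)).
Proof.
move=> sf Uz; apply: (@is_derive_affine _ _ _ f (fun s => (s, t, p)) (basis1 R)).
  exact: line1E.
exact: smooth_in_is_derive sf Uz.
Qed.

Lemma smooth_in_line2 (R : realType) (W : normedModType R) (U : set (R * R * R))
    (f : R * R * R -> W) (e t p : R) : smooth_in U f -> U (e, t, p) ->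
  is_derive t 1 (fun s => f (e, s, p)) ('D_(basis2 R) f (e, t, p)).
Proof.
move=> sf Uz; apply: (@is_derive_affine _ _ _ f (fun s => (e, s, p)) (basis2 R)).
  exact: line2E.
exact: smooth_in_is_derive sf Uz.
Qed.

Lemma smooth_in_line3 (R : realType) (W : normedModType R) (U : set (R * R * R))
    (f : R * R * R -> W) (e t p : R) : smooth_in U f -> U (e, t, p) ->
  is_derive p 1 (fun s => f (e, t, s)) ('D_(basis3 R) f (e, t, p)).
Proof.
move=> sf Uz; apply: (@is_derive_affine _ _ _ f (fun s => (e, t, s)) (basis3 R)).
  exact: line3E.
exact: smooth_in_is_derive sf Uz.
Qed.

(** * The regularized length density and its flux *)

Lemma is_derive_inv (R : realType) (V : normedModType R) (f : V -> R) x v df :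
  f x != 0 -> is_derive x v f df ->
  is_derive x v (fun y => (f y)^-1) (- df / f x ^+ 2).
Proof.
move=> fx0 fd; have fv := @ex_derive _ _ _ _ _ _ _ fd.
apply: DeriveDef; first exact: derivableV.
rewrite deriveV// (@derive_val _ _ _ _ _ _ _ fd) mulNr [df / _]mulrC.
by rewrite -scaleNr.
Qed.

Definition reg_norm (R : realType) n (d : R) (y : 'rV[R]_n) :=
  Num.sqrt (dot y y + d).

Lemma reg_norm_sqr (R : realType) n (d : R) (y : 'rV[R]_n) : 0 < d ->
  reg_norm d y ^+ 2 = dot y y + d.
Proof. by move=> d0; rewrite sqr_sqrtr// addr_ge0 ?dot_ge0// ltW. Qed.

Lemma reg_norm_gt0 (R : realType) n (d : R) (y : 'rV[R]_n) : 0 < d ->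
  0 < reg_norm d y.
Proof. by move=> d0; rewrite sqrtr_gt0 ltr_wpDl// dot_ge0. Qed.

Lemma enorm_sqr (R : realType) n (a : 'rV[R]_n) : enorm a ^+ 2 = dot a a.
Proof. by rewrite sqr_sqrtr// dot_ge0. Qed.

Lemma enorm_gt0 (R : realType) n (a : 'rV[R]_n) : a != 0 -> 0 < enorm a.
Proof. by move=> a0; rewrite sqrtr_gt0 dot_gt0. Qed.

Lemma is_derive_reg_norm (R : realType) n (d : R) (y : R -> 'rV[R]_n) (x : R) dy :
  0 < d -> is_derive x 1 y dy ->
  is_derive x 1 (fun s => reg_norm d (y s)) (dot (y x) dy / reg_norm d (y x)).
Proof.
move=> d0 yd; have F0 := reg_norm_gt0 (y x) d0.
have h : is_derive x 1 (fun s => dot (y s) (y s) + d)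
    (dot dy (y x) + dot (y x) dy + 0).
  by apply: is_deriveD; exact: is_derive_dot.
apply: is_derive_eq; first by apply: is_derive_sqrt h; rewrite -sqrtr_gt0.
rewrite -/(reg_norm _ _) (dotC dy); field.
by rewrite gt_eqF.
Qed.

Lemma is_derive_enorm (R : realType) n (a : R -> 'rV[R]_n) (x : R) da :
  a x != 0 -> is_derive x 1 a da ->
  is_derive x 1 (fun s => enorm (a s)) (dot (a x) da / enorm (a x)).
Proof.
move=> a0 ad; have v0 := enorm_gt0 a0.
have h : is_derive x 1 (fun s => dot (a s) (a s)) (dot da (a x) + dot (a x) da).
  exact: is_derive_dot.
apply: is_derive_eq; first by apply: is_derive_sqrt h; rewrite -sqrtr_gt0.
rewrite -/(enorm _) (dotC da); field.
by rewrite gt_eqF.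
Qed.

(** This is [(F v)_t] when [y], [a] are [X_eps], [X_p] and [dy], [da] are their derivatives in
    [t]. *)
Definition density_derivative (R : realType) n (d : R) (y dy a da : 'rV[R]_n) :=
  dot y dy / reg_norm d y * enorm a + reg_norm d y * (dot a da / enorm a).

Lemma is_derive_density (R : realType) n (d : R) (y a : R -> 'rV[R]_n) (x : R) dy da :
  0 < d -> a x != 0 -> is_derive x 1 y dy -> is_derive x 1 a da ->
  is_derive x 1 (fun s => reg_norm d (y s) * enorm (a s))
    (density_derivative d (y x) dy (a x) da).
Proof.
move=> d0 a0 yd ad; apply: is_derive_mul; first exact: is_derive_reg_norm.
exact: is_derive_enorm.
Qed.

(** The function [H] of the overview, with [y], [yp], [T], [a] standing for [X_eps], its derivative
    in [p], [X_t] and [X_p]. *)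
Definition flux (R : realType) n (d : R) (y yp T a : 'rV[R]_n) :=
  (dot y yp / reg_norm d y + dot T a * reg_norm d y) / enorm a.

Definition flux_derivative (R : realType) n (d : R)
    (y yp ypp T Tp a b : 'rV[R]_n) :=
  let F := reg_norm d y in let v := enorm a in
  ((dot yp yp + dot y ypp) / F - dot y yp ^+ 2 / F ^+ 3
    + (dot Tp a + dot T b) * F + dot T a * (dot y yp / F)) / v
  - (dot y yp / F + dot T a * F) * dot a b / v ^+ 3.

Lemma is_derive_flux (R : realType) n (d : R) (y yp T a : R -> 'rV[R]_n) (x : R)
    ypp Tp b : 0 < d -> a x != 0 ->
  is_derive x 1 y (yp x) -> is_derive x 1 yp ypp ->
  is_derive x 1 T Tp -> is_derive x 1 a b ->
  is_derive x 1 (fun s => flux d (y s) (yp s) (T s) (a s))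
    (flux_derivative d (y x) (yp x) ypp (T x) Tp (a x) b).
Proof.
move=> d0 a0 yd ypd Td ad.
have F0 := reg_norm_gt0 (y x) d0; have v0 := enorm_gt0 a0.
have Fd := is_derive_reg_norm d0 yd; have vd := is_derive_enorm a0 ad.
apply: is_derive_eq.
  apply: is_derive_mul; last by apply: is_derive_inv vd; rewrite gt_eqF.
  apply: is_deriveD.
    apply: is_derive_mul (is_derive_dot yd ypd) _.
    by apply: is_derive_inv Fd; rewrite gt_eqF.
  exact: is_derive_mul (is_derive_dot Td ad) Fd.
rewrite /flux_derivative; field.
by rewrite !gt_eqF.
Qed.

(** Here [b] stands for [X_pp]. The hypotheses are, in order: orthogonality, its derivative in [p],
    curve shortening, and the linearized flow paired with [y]. The terms in [ypp] and [Tp] occur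
    identically on both sides and cancel. *)
Lemma density_derivative_le_flux_derivative (R : realType) n (d mu : R)
    (y yp ypp yt a b T Tp : 'rV[R]_n) : 0 < d -> a != 0 -> dot y a = 0 ->
  dot yp a + dot y b = 0 -> T = (dot a a)^-1 *: b + mu *: a ->
  dot y yt = dot y ypp / dot a a
             - 2 * dot y b * dot a yp / dot a a ^+ 2 + mu * dot y yp ->
  density_derivative d y yt a Tp <= flux_derivative d y yp ypp T Tp a b.
Proof.
move=> d0 a0 ya ypa TE ytE.
have F0 := reg_norm_gt0 y d0; have v0 := enorm_gt0 a0.
have F2 := reg_norm_sqr y d0; have v2 := enorm_sqr a.
have g1 := dot_gram yp ya; have g2 := dot_gram b ya.
have cs := dot_cauchy_schwarz a yp; have cs2 := dot_cauchy_schwarz a b.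
rewrite /density_derivative /flux_derivative TE !(dotDl, dotZl) ytE (dotC b a).
have -> : dot a yp = - dot y b by apply/eqP; rewrite dotC -addr_eq0; apply/eqP.
move: F0 v0 F2 v2 g1 g2 cs cs2 ypa.
rewrite (dotC Tp a) (dotC yp a).
move: (reg_norm d y) (enorm a) => F v F0 v0 F2 v2.
rewrite -!v2 => g1 g2 cs cs2 ypa.
have ayp : dot a yp = - dot y b by apply/eqP; rewrite -addr_eq0; apply/eqP.
rewrite ayp in g1 cs.
rewrite sqrrN in g1 cs.
move: (dot y y) (dot y yp) (dot yp yp) (dot y ypp) (dot b b) (dot a b) (dot y b)
  (dot a Tp) F2 g1 g2 cs cs2
  => yy yyp ypyp yypp bb ab yb aTp F2 g1 g2 cs cs2.
have yyE : yy = F ^+ 2 - d by rewrite F2 addrK.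
rewrite -subr_ge0.
(* The difference of the two sides over a common denominator: [mu], [yypp] and [aTp] have
   disappeared, and the numerator is grouped into two Gram type expressions. *)
have -> : ((ypyp + yypp) / F - yyp ^+ 2 / F ^+ 3 +
  (aTp + ((v ^+ 2)^-1 * bb + mu * ab)) * F +
  ((v ^+ 2)^-1 * ab + mu * v ^+ 2) * (yyp / F)) / v -
  (yyp / F + ((v ^+ 2)^-1 * ab + mu * v ^+ 2) * F) * ab / v ^+ 3 -
  ((yypp / v ^+ 2 - 2 * yb * - yb / (v ^+ 2) ^+ 2 + mu * yyp) / F * v +
   F * (aTp / v)) =
  ((F ^+ 2 * (v ^+ 2 * ypyp - yb ^+ 2) - v ^+ 2 * yyp ^+ 2) * v ^+ 2
   + F ^+ 2 * (F ^+ 2 * (v ^+ 2 * bb - ab ^+ 2) - v ^+ 2 * yb ^+ 2)) / (F ^+ 3 * v ^+ 5).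
  by field; rewrite !gt_eqF.
rewrite divr_ge0//; last by rewrite mulr_ge0// exprn_ge0// ltW.
have d_ge0 := ltW d0.
(* Each group is an instance of [dot_gram], for [yp] and for [b], with [|y|^2] enlarged to [F^2];
   the Cauchy-Schwarz bounds [cs] and [cs2] make the factor multiplied by it nonnegative. *)
rewrite addr_ge0//; apply: mulr_ge0; rewrite ?sqr_ge0// subr_ge0.
  by apply: le_trans g1 _; rewrite yyE ler_wpM2r ?gerBl// subr_ge0.
by apply: le_trans g2 _; rewrite yyE ler_wpM2r ?gerBl// subr_ge0.
Qed.

(** * The flow equation differentiated in [eps], and the curvature vector *)

(** Formally, one differentiates the equation for [T] and pairs it with [y]; the derivative of [mu]
    would be multiplied by [<y,a> = 0]. To avoid differentiating [mu], the identity [<y,Z> = 0] is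
    differentiated instead, where [Z], the tangential part [mu a] of [T], is differentiable as a
    difference. *)
Lemma dot_deriveE (R : realType) n (y a b T : R -> 'rV[R]_n) (mu : R -> R)
    (x r : R) dy da db dT : 0 < r -> a x != 0 ->
  is_derive x 1 y dy -> is_derive x 1 a da -> is_derive x 1 b db ->
  is_derive x 1 T dT ->
  (forall e, x <= e <= x + r -> dot (y e) (a e) = 0) ->
  (forall e, x <= e <= x + r ->
     T e = (dot (a e) (a e))^-1 *: b e + mu e *: a e) ->
  dot (y x) dT = dot (y x) db / dot (a x) (a x)
    - 2 * dot (y x) (b x) * dot (a x) da / dot (a x) (a x) ^+ 2
    + mu x * dot (y x) da.
Proof.
move=> r0 a0 yd ad bd Td ya TE.
have xx : x <= x <= x + r by rewrite lexx lerDl ltW.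
have q0 : dot (a x) (a x) != 0 by rewrite gt_eqF// dot_gt0.
pose Z e := T e - (dot (a e) (a e))^-1 *: b e.
have ZE e : x <= e <= x + r -> Z e = mu e *: a e.
  by move=> xe; rewrite /Z TE// addrAC subrr add0r.
have qd := is_derive_inv (f := fun e => dot (a e) (a e)) q0 (is_derive_dot ad ad).
have Zd : is_derive x 1 Z _ := is_deriveB Td (is_derive_scale qd bd).
have yZ e : x <= e <= x + r -> dot (y e) (Z e) = 0.
  by move=> xe; rewrite ZE// dotZr ya// mulr0.
have E2 := derive_right_eq0 (is_derive_dot yd ad) r0 ya.
have := derive_right_eq0 (is_derive_dot yd Zd) r0 yZ.
rewrite (ZE _ xx) !(dotDr, dotNr, dotZr) (dotC da).
have -> : dot dy (a x) = - dot (y x) da by apply/eqP; rewrite -addr_eq0 E2.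
set S := - (_ + _); rewrite addrCA => /eqP; rewrite addr_eq0 => /eqP ->.
by rewrite /S; field.
Qed.

(** Product rule for [v^-1 a] with [a = c_p] and [v = |a|], where [v_p = <a,b> / v]. *)
Lemma dds_ddsE (R : realType) n (c : R -> 'rV[R]_n) (p : R) b :
  derive1 c p != 0 -> is_derive p 1 (derive1 c) b ->
  dds c (dds c c) p = (dot (derive1 c p) (derive1 c p))^-1 *: b
    - (dot (derive1 c p) b / dot (derive1 c p) (derive1 c p) ^+ 2) *: derive1 c p.
Proof.
move=> a0 ad; have v0 := enorm_gt0 a0.
have v0' : enorm (derive1 c p) != 0 by rewrite gt_eqF.
have h := is_derive_scale (is_derive_inv (f := fun q => enorm (derive1 c q)) v0'
  (is_derive_enorm a0 ad)) ad.
rewrite /dds [X in _ *: X]derive1E /dds (@derive_val _ _ _ _ _ _ _ h) /speed.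
rewrite -enorm_sqr scalerDr !scalerA addrC -[X in _ = _ + X]scaleNr.
by congr (_ *: _ + _ *: _); field.
Qed.

(** * Integrals over one period depending on a parameter *)

Lemma continuous_pair (T U V : topologicalType) (f : T -> U) (g : T -> V) x :
  {for x, continuous f} -> {for x, continuous g} ->
  {for x, continuous (fun y => (f y, g y))}.
Proof.
exact: (@cvg_pair _ _ _ (nbhs x) (nbhs (f x)) (nbhs (g x)) _ _ _ f g).
Qed.

Lemma continuous_slice (R : realType) (g : R -> R -> R) (t p : R) :
  {for (t, p), continuous (fun z => g z.1 z.2)} -> {for p, continuous (g t)}.
Proof.
move=> cg; apply: (@continuous_comp _ _ _ (fun p => (t, p)) (fun z => g z.1 z.2)).
  by apply: continuous_pair; [exact: cvg_cst|exact: cvg_id].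
exact: cg.
Qed.

(** The tube lemma for the compact segment [[0, 1]], combined with a uniform bound near the slice at
    [t]. It provides the constant majorant for differentiation under the integral. *)
Lemma segment_tube_bounded (R : realType) (g : R -> R -> R) (V : set (R * R)) (t : R) :
  open V -> (forall p : R, 0 <= p <= 1 -> V (t, p)) ->
  (forall p, 0 <= p <= 1 -> {for (t, p), continuous (fun z => g z.1 z.2)}) ->
  exists r M, 0 < r /\ forall s p, `|t - s| < r -> 0 <= p <= 1 ->
    V (s, p) /\ `|g s p| <= M.
Proof.
move=> oV tV cg.
have ct : {within `[0, 1], continuous (fun p => g t p)}.
  apply: continuous_in_subspaceT => p; rewrite inE /= in_itv /= => p01.
  exact: continuous_slice (cg _ p01).
have := continuous_compact ct (@segment_compact _ 0 1) => /compact_bounded[M0 [_ /(_ (M0 + 1))]].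
rewrite ltrDl ltr01 => /(_ isT) M0b.
(* On the slice itself [|g|] is at most [M0 + 1], and continuity with tolerance 1 accounts for the
   rest of [M0 + 2]. Compactness makes the neighbourhood of [t] independent of [p]. *)
have : \forall s \near t, `[(0:R), 1] `<=` (fun p => V (s, p) /\ `|g s p| <= M0 + 2).
  have /compact_near_coveringP nc := @segment_compact R 0 1.
  apply: (nc R (nbhs t) (fun s p => V (s, p) /\ `|g s p| <= M0 + 2)) => p.
  rewrite /= in_itv /= => p01.
  have : \forall z \near (t, p), V z /\ `|g z.1 z.2| <= M0 + 2.
    apply: filterI; first by apply: open_nbhs_nbhs; split => //; exact: tV.
    have /cvgrPdist_le /(_ 1 ltr01) := cg _ p01; apply: filterS => z /= gz.
    have gp : `|g t p| <= M0 + 1.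
      by apply: M0b; exists p => //=; rewrite in_itv.
    rewrite -[g z.1 z.2](subKr (g t p)); apply: le_trans (ler_normB _ _) _.
    by have -> : M0 + 2 = M0 + 1 + 1 by [ring]; exact: lerD.
  move=> [[A B] /= [At Bp] AB]; exists (B, A) => //= -[p' s] /= [Bp' As].
  exact: (AB (s, p')).
move=> /nbhs_ballP[r /= r0 tr]; exists r, (M0 + 2); split => // s p ts p01.
by have := tr s; rewrite -ball_normE => /(_ ts p); rewrite /= in_itv; exact.
Qed.

Lemma integrable_segment (R : realType) (g : R -> R) :
  (forall p : R, 0 <= p <= 1 -> {for p, continuous g}) ->
  (@lebesgue_measure R).-integrable `[0, 1] (EFin \o g).
Proof.
move=> cg; apply: continuous_compact_integrable; first exact: segment_compact.
by apply: continuous_in_subspaceT => p; rewrite inE /= in_itv /= => /cg.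
Qed.

Lemma integral_segmentE (R : realType) (g : R -> R) :
  (forall p : R, 0 <= p <= 1 -> {for p, continuous g}) ->
  (\int[@lebesgue_measure R]_(p in `[0%R, 1%R]) (g p)%:E
    = (\int[@lebesgue_measure R]_(p in `[0%R, 1%R]) g p)%:E)%E.
Proof.
move=> cg; rewrite /Rintegral fineK//.
by apply: integrable_fin_num => //; exact: integrable_segment.
Qed.

Lemma is_derive_integral_segment (R : realType) (G Gt : R -> R -> R)
    (V : set (R * R)) (t : R) : open V -> (forall p : R, 0 <= p <= 1 -> V (t, p)) ->
  (forall t p : R, V (t, p) -> is_derive t 1 (G ^~ p) (Gt t p)) ->
  (forall t p : R, V (t, p) -> {for (t, p), continuous (fun z => G z.1 z.2)}) ->
  (forall t p : R, V (t, p) -> {for (t, p), continuous (fun z => Gt z.1 z.2)}) ->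
  is_derive t 1 (fun s => \int[@lebesgue_measure R]_(p in `[0%R, 1%R]) G s p)
    (\int[@lebesgue_measure R]_(p in `[0%R, 1%R]) Gt t p).
Proof.
move=> oV tV dG cG cGt.
have [r [M [r0 rM]]] := segment_tube_bounded oV tV (fun p p01 => cGt _ _ (tV p p01)).
have It : `]t - r, t + r[%classic t.
  by rewrite /= in_itv /= ltrBlDr ltrDl r0.
have I s : `]t - r, t + r[%classic s -> `|t - s| < r.
  by rewrite /= in_itv /= => /andP[rs sr]; rewrite ltr_distlC rs sr.
have intG s : `]t - r, t + r[%classic s ->
    (@lebesgue_measure R).-integrable `[0, 1] (EFin \o G s).
  move=> /I ts; apply: integrable_segment => p p01; apply: continuous_slice.
  by apply: cG; have [] := rM s p ts p01.
have derG s p : `]t - r, t + r[%classic s -> `[0, 1]%classic p ->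
    derivable (G ^~ p) s 1.
  rewrite /= [p \in _]in_itv => /I ts p01.
  exact: (@ex_derive _ _ _ _ _ _ _ (dG s p (rM s p ts p01).1)).
have GE s p : V (s, p) -> partial1of2 G s p = Gt s p.
  by move=> Vsp; rewrite partial1of2E (@derive_val _ _ _ _ _ _ _ (dG s p Vsp)).
have M0 : 0 <= M.
  have := rM t 0; rewrite subrr normr0 lexx ler01 => /(_ r0 isT)[_].
  exact: le_trans.
have GM s p : `]t - r, t + r[%classic s -> `[0, 1]%classic p ->
    `|partial1of2 G s p| <= cst M p.
  by rewrite /= [p \in _]in_itv => /I ts p01; rewrite GE; have [] := rM s p ts p01.
have intM : (@lebesgue_measure R).-integrable `[0, 1] (EFin \o cst M).
  by apply: integrable_segment => p _; exact: cvg_cst.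
have mI : measurable (`[0, 1]%classic : set (measurableTypeR R)) by [].
have D := derivable_under_integral mI It intG derG (fun _ => M0) intM GM.
have DE := differentiation_under_integral mI It intG derG (fun _ => M0) intM GM.
apply: DeriveDef => //; rewrite -derive1E DE.
by apply: eq_Rintegral => p; rewrite inE /= in_itv /= => p01; rewrite GE//; exact: tV.
Qed.

(** The primitive [K] of [g] minus [h] has a nonpositive derivative, hence decreases weakly from 0
    to 1. Only [g] is ever integrated, so [dh] may be any pointwise derivative. *)
Lemma Rintegral_le_primitive (R : realType) (g h dh : R -> R) :
  (forall p : R, 0 <= p <= 1 -> {for p, continuous g}) ->
  (forall p : R, 0 <= p <= 1 -> is_derive p 1 h (dh p)) ->
  (forall p : R, 0 <= p <= 1 -> g p <= dh p) ->
  \int[@lebesgue_measure R]_(p in `[0%R, 1%R]) g p <= h 1 - h 0.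
Proof.
move=> cg hd gdh; have ig := integrable_segment cg.
pose K x := \int[@lebesgue_measure R]_(p in `[0%R, x]) g p.
have cK : {within `[0, 1], continuous K}.
  exact: (parameterized_integral_continuous ler01 ig).
have ch : {within `[0, 1], continuous h} by exact: continuous_itv_derive hd.
have dK (x : R) : x \in `]0, 1[ -> is_derive x 1 (K - h) (g x - dh x).
  rewrite in_itv /= => /andP[x0 x1].
  have x01 : 0 <= x <= 1 by rewrite !ltW.
  have [D DE] := continuous_FTC1_closed x1 ig x0 (cg x x01).
  apply: is_deriveB; last exact: hd.
  apply: DeriveDef; first exact: D.
  by rewrite -derive1E; exact: DE.
suff : (K - h) 1 <= (K - h) 0.
  have -> : (K - h) 0 = K 0 - h 0 by [].
  have -> : (K - h) 1 = K 1 - h 1 by [].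
  by rewrite {2}/K set_itv1 Rintegral_set1 sub0r lerBlDr addrC.
apply: (@ler0_derive1_le_cc _ (K - h) 0 1).
- by move=> x /dK /(@ex_derive _ _ _ _ _ _ _).
- move=> x xx; rewrite derive1E (@derive_val _ _ _ _ _ _ _ (dK x xx)) subr_le0.
  by apply: gdh; move: xx; rewrite in_itv /= => /andP[? ?]; rewrite !ltW.
- by move=> x; apply: continuousB; [exact: cK|exact: ch].
- by rewrite in_itv /= lexx ler01.
- by rewrite in_itv /= lexx ler01.
- exact: ler01.
Qed.

(** The derivative of the integral is at most [H t 1 - H t 0 = 0]. The flux conditions are asked
    only for [a < t < b], because they will be derived from one-sided derivatives that need room on
    both sides of [t]. *)
Lemma integral_nonincreasing (R : realType) (G Gt H Hp : R -> R -> R)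
    (V : set (R * R)) (a b : R) : a <= b -> open V ->
  (forall t p : R, a <= t <= b -> 0 <= p <= 1 -> V (t, p)) ->
  (forall t p : R, V (t, p) -> is_derive t 1 (G ^~ p) (Gt t p)) ->
  (forall t p : R, V (t, p) -> {for (t, p), continuous (fun z => G z.1 z.2)}) ->
  (forall t p : R, V (t, p) -> {for (t, p), continuous (fun z => Gt z.1 z.2)}) ->
  (forall t p : R, a < t < b -> 0 <= p <= 1 -> is_derive p 1 (H t) (Hp t p)) ->
  (forall t p : R, a < t < b -> 0 <= p <= 1 -> Gt t p <= Hp t p) ->
  (forall t : R, a < t < b -> H t 1 = H t 0) ->
  \int[@lebesgue_measure R]_(p in `[0%R, 1%R]) G b p
    <= \int[@lebesgue_measure R]_(p in `[0%R, 1%R]) G a p.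
Proof.
move=> ab oV abV dG cG cGt dH GH H01.
pose Phi s := \int[@lebesgue_measure R]_(p in `[0%R, 1%R]) G s p.
rewrite -/(Phi b) -/(Phi a).
have dPhi (s : R) : a <= s <= b -> is_derive s 1 Phi
    (\int[@lebesgue_measure R]_(p in `[0%R, 1%R]) Gt s p).
  move=> sab; apply: (is_derive_integral_segment oV _ dG cG cGt).
  by move=> p; exact: abV.
apply: (@ler0_derive1_le_cc _ Phi a b).
- move=> x; rewrite in_itv /= => /andP[? ?].
  by apply: (@ex_derive _ _ _ _ _ _ _ (dPhi x _)); rewrite !ltW.
- move=> x; rewrite in_itv /= => xab.
  have xab' : a <= x <= b by case/andP: xab => ? ?; rewrite !ltW.
  rewrite derive1E (@derive_val _ _ _ _ _ _ _ (dPhi x xab')).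
  have cx (p : R) : 0 <= p <= 1 -> {for p, continuous (Gt x)}.
    by move=> p01; apply: continuous_slice; apply: cGt; exact: abV.
  have := Rintegral_le_primitive cx (fun p => dH x p xab) (fun p => GH x p xab).
  by rewrite H01// subrr.
- exact: continuous_itv_derive dPhi.
- by rewrite in_itv /= lexx ab.
- by rewrite in_itv /= lexx ab.
- by [].
Qed.

(** * Bounds and continuity for the regularization *)

Lemma reg_norm_ge (R : realType) n (d : R) (y : 'rV[R]_n) : 0 < d ->
  enorm y <= reg_norm d y.
Proof. by move=> d0; apply: ler_wsqrtr; rewrite lerDl ltW. Qed.

(** Squaring both sides leaves the nonnegative cross term [2 k |y|]. Taking [d = k^2] gives an error
    [k] uniform in [y]. *)
Lemma reg_norm_le (R : realType) n (k : R) (y : 'rV[R]_n) : 0 < k ->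
  reg_norm (k ^+ 2) y <= enorm y + k.
Proof.
move=> k0; have k2 : 0 < k ^+ 2 by rewrite exprn_gt0.
have yk : 0 <= enorm y + k by rewrite addr_ge0 ?sqrtr_ge0// ltW.
rewrite -(ler_pXn2r (ltn0Sn 1)) ?nnegrE ?(ltW (reg_norm_gt0 y k2))//.
rewrite reg_norm_sqr// sqrrD enorm_sqr lerD2r lerDl mulrn_wge0//.
by rewrite mulr_ge0 ?sqrtr_ge0// ltW.
Qed.

Lemma continuous_reg_norm (R : realType) (T : topologicalType) n (d : R)
    (y : T -> 'rV[R]_n) x :
  {for x, continuous y} -> {for x, continuous (fun z => reg_norm d (y z))}.
Proof.
move=> cy; apply: (continuous_comp _ (@sqrt_continuous R _)).
by apply: cvgD; [exact: continuous_dot|exact: cvg_cst].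
Qed.

Lemma continuous_enorm (R : realType) (T : topologicalType) n
    (y : T -> 'rV[R]_n) x :
  {for x, continuous y} -> {for x, continuous (fun z => enorm (y z))}.
Proof.
move=> cy; apply: (continuous_comp _ (@sqrt_continuous R _)).
exact: continuous_dot.
Qed.

Lemma continuous_density (R : realType) (T : topologicalType) n (d : R)
    (y a : T -> 'rV[R]_n) x : {for x, continuous y} -> {for x, continuous a} ->
  {for x, continuous (fun z => reg_norm d (y z) * enorm (a z))}.
Proof.
move=> cy ca; apply: cvgM; first exact: continuous_reg_norm.
exact: continuous_enorm.
Qed.

Lemma continuous_density_derivative (R : realType) (T : topologicalType) n
    (d : R) (y dy a da : T -> 'rV[R]_n) x : 0 < d -> a x != 0 ->
  {for x, continuous y} -> {for x, continuous dy} ->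
  {for x, continuous a} -> {for x, continuous da} ->
  {for x, continuous (fun z => density_derivative d (y z) (dy z) (a z) (da z))}.
Proof.
move=> d0 a0 cy cdy ca cda; have F0 := reg_norm_gt0 (y x) d0.
have v0 := enorm_gt0 a0; apply: cvgD; apply: cvgM.
- apply: cvgM; first exact: continuous_dot.
  by apply: cvgV; [rewrite gt_eqF|exact: continuous_reg_norm].
- exact: continuous_enorm.
- exact: continuous_reg_norm.
- apply: cvgM; first exact: continuous_dot.
  by apply: cvgV; [rewrite gt_eqF|exact: continuous_enorm].
Qed.

(** * Contraction along the flow *)

Lemma derive_right_eq (R : realType) (V : normedModType R) (f g : R -> V)
    (x r : R) df dg : is_derive x 1 f df -> is_derive x 1 g dg -> 0 < r ->
  (forall y, x <= y <= x + r -> f y = g y) -> df = dg.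
Proof.
move=> fd gd r0 fg; apply/eqP; rewrite -subr_eq0; apply/eqP.
apply: (derive_right_eq0 (is_deriveB fd gd) r0) => y xy.
by rewrite fctE fg// subrr.
Qed.

Lemma smooth_in_slice_continuous (R : realType) (W : normedModType R)
    (U : set (R * R * R)) (f : R * R * R -> W) e (z : R * R) :
  smooth_in U f -> U (e, z.1, z.2) ->
  {for z, continuous (fun z => f (e, z.1, z.2))}.
Proof.
move=> sf Uz.
apply: (@continuous_comp _ _ _ (fun z : R * R => (e, z.1, z.2)) f).
  apply: continuous_pair; last exact: cvg_snd.
  by apply: continuous_pair; [exact: cvg_cst|exact: cvg_fst].
exact: smooth_in_continuous sf Uz.
Qed.

Lemma open_regular_slice (R : realType) n (U : set (R * R * R))
    (f : R * R * R -> 'rV[R]_n) e : open U -> smooth_in U f ->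
  open [set z : R * R | U (e, z.1, z.2) /\ f (e, z.1, z.2) != 0].
Proof.
move=> oU sf; rewrite openE => z /= [Uz fz]; apply: filterI.
  have c : {for z, continuous (fun z : R * R => (e, z.1, z.2))}.
    apply: continuous_pair; last exact: cvg_snd.
    by apply: continuous_pair; [exact: cvg_cst|exact: cvg_fst].
  by apply: c; exact: open_nbhs_nbhs.
have cf := smooth_in_slice_continuous sf Uz.
have := continuous_dot cf cf => /cvgr_gt /(_ 0).
by rewrite dot_gt0 => /(_ fz); apply: filterS => y; rewrite /= dot_gt0.
Qed.

(** The integral of [|X_eps| ds] at the final time is bounded by its value on the diagonal. The
    hypotheses range over all [s] in [[e, t]], not only [s = e], since they get differentiated in
    the first variable. *)
Lemma flow_contraction (R : realType) n (U : set (R * R * R))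
    (f : R * R * R -> 'rV[R]_n) (e t1 : R) :
  let Y := 'D_(basis1 R) f in let A := 'D_(basis3 R) f in
  open U -> smooth_in U f -> e <= t1 ->
  (forall s t p : R, e <= s -> s <= t -> t <= t1 ->
    [/\ U (s, t, p), A (s, t, p) != 0, dot (Y (s, t, p)) (A (s, t, p)) = 0,
        f (s, t, p + 1) = f (s, t, p) &
        exists m, 'D_(basis2 R) f (s, t, p)
          = (dot (A (s, t, p)) (A (s, t, p)))^-1 *: 'D_(basis3 R) A (s, t, p)
            + m *: A (s, t, p)]) ->
  (\int[@lebesgue_measure R]_(p in `[0%R, 1%R])
      (enorm (Y (e, t1, p)) * enorm (A (e, t1, p)))%:E
   <= \int[@lebesgue_measure R]_(p in `[0%R, 1%R])
      (enorm (Y (e, e, p)) * enorm (A (e, e, p)))%:E)%E.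
Proof.
move=> Y A oU sf et1 hyp.
have hU s t p : e <= s -> s <= t -> t <= t1 -> U (s, t, p).
  by move=> es st tt1; have [] := hyp s t p es st tt1.
have hA s t p : e <= s -> s <= t -> t <= t1 -> A (s, t, p) != 0.
  by move=> es st tt1; have [] := hyp s t p es st tt1.
have hYA s t p : e <= s -> s <= t -> t <= t1 ->
    dot (Y (s, t, p)) (A (s, t, p)) = 0.
  by move=> es st tt1; have [] := hyp s t p es st tt1.
have hper s t p : e <= s -> s <= t -> t <= t1 -> f (s, t, p + 1) = f (s, t, p).
  by move=> es st tt1; have [] := hyp s t p es st tt1.
pose T := 'D_(basis2 R) f; pose B := 'D_(basis3 R) A.
(* The coefficient [m] is given only pointwise; pairing the equation with [A] recovers it by an
   explicit formula. *)
pose mu z := dot (T z - (dot (A z) (A z))^-1 *: B z) (A z) / dot (A z) (A z).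
have hT s t p : e <= s -> s <= t -> t <= t1 -> T (s, t, p)
    = (dot (A (s, t, p)) (A (s, t, p)))^-1 *: B (s, t, p)
      + mu (s, t, p) *: A (s, t, p).
  move=> es st tt1; have [_ a0 _ _ [m mE]] := hyp s t p es st tt1.
  have q0 : dot (A (s, t, p)) (A (s, t, p)) != 0 by rewrite gt_eqF// dot_gt0.
  by rewrite /mu /T mE -/B addrAC subrr add0r dotZl mulfK.
have sY : smooth_in U Y by exact: smooth_in_derive.
have sA : smooth_in U A by exact: smooth_in_derive.
have sT : smooth_in U T by exact: smooth_in_derive.
have sB : smooth_in U B by exact: smooth_in_derive.
pose Yp := 'D_(basis3 R) Y; pose Ypp := 'D_(basis3 R) Yp.
have sYp : smooth_in U Yp by exact: smooth_in_derive.
pose Yt := 'D_(basis2 R) Y; pose Tp := 'D_(basis3 R) T.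
have sYt : smooth_in U Yt by exact: smooth_in_derive.
have sTp : smooth_in U Tp by exact: smooth_in_derive.
have AtE z : U z -> 'D_(basis2 R) A z = Tp z.
  exact: smooth_in_derive_symmetric.
have TeE z : U z -> 'D_(basis1 R) T z = Yt z.
  exact: smooth_in_derive_symmetric.
have AeE z : U z -> 'D_(basis1 R) A z = Yp z.
  exact: smooth_in_derive_symmetric.
(* Two exchanges of derivatives are needed. The second is known only on [U], so it must hold near
   [z] before being differentiated in [p]. *)
have BeE z : U z -> 'D_(basis1 R) B z = Ypp z.
  move=> Uz; have -> : 'D_(basis1 R) B z = 'D_(basis3 R) ('D_(basis1 R) A) z.
    exact: smooth_in_derive_symmetric oU sA Uz.
  apply: near_eq_derive; have := open_nbhs_nbhs (conj oU Uz).
  by apply: filterS => y; exact: AeE.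
(* An open set is required for differentiation under the integral. It may exceed the region
   [e <= t <= t1]; the density is smooth on it because [A] does not vanish, and the flux inequality
   is used only inside that region. *)
pose V := [set z : R * R | U (e, z.1, z.2) /\ A (e, z.1, z.2) != 0].
have oV : open V by exact: open_regular_slice.
have main d : 0 < d ->
    \int[@lebesgue_measure R]_(p in `[0%R, 1%R])
      (reg_norm d (Y (e, t1, p)) * enorm (A (e, t1, p)))
    <= \int[@lebesgue_measure R]_(p in `[0%R, 1%R])
      (reg_norm d (Y (e, e, p)) * enorm (A (e, e, p))).
  move=> d0.
  pose Gt t p := density_derivative d (Y (e, t, p)) (Yt (e, t, p))
    (A (e, t, p)) (Tp (e, t, p)).
  pose H t p := flux d (Y (e, t, p)) (Yp (e, t, p)) (T (e, t, p)) (A (e, t, p)).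
  pose Hp t p := flux_derivative d (Y (e, t, p)) (Yp (e, t, p)) (Ypp (e, t, p))
    (T (e, t, p)) (Tp (e, t, p)) (A (e, t, p)) (B (e, t, p)).
  apply: (@integral_nonincreasing _
    (fun t p => reg_norm d (Y (e, t, p)) * enorm (A (e, t, p))) Gt H Hp V).
  - exact: et1.
  - exact: oV.
  - by move=> t p /andP[et tt1] _; split; [exact: hU|exact: hA].
  - move=> t p [/= Uz Az]; apply: is_derive_density; [exact: d0|exact: Az| |].
      exact: (smooth_in_line2 sY Uz).
    by rewrite -(AtE _ Uz); exact: (smooth_in_line2 sA Uz).
  - move=> t p [/= Uz Az].
    have cY := smooth_in_slice_continuous (z := (t, p)) sY Uz.
    have cA := smooth_in_slice_continuous (z := (t, p)) sA Uz.
    exact: (continuous_density cY cA).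
  - move=> t p [/= Uz Az].
    have cY := smooth_in_slice_continuous (z := (t, p)) sY Uz.
    have cYt := smooth_in_slice_continuous (z := (t, p)) sYt Uz.
    have cA := smooth_in_slice_continuous (z := (t, p)) sA Uz.
    have cTp := smooth_in_slice_continuous (z := (t, p)) sTp Uz.
    exact: (continuous_density_derivative d0 _ cY cYt cA cTp).
  - move=> t p /andP[/ltW et /ltW tt1] _.
    have Uz : U (e, t, p) by exact: hU.
    apply: is_derive_flux; first exact: d0.
    + exact: hA.
    + exact: (smooth_in_line3 sY Uz).
    + exact: (smooth_in_line3 sYp Uz).
    + exact: (smooth_in_line3 sT Uz).
    + exact: (smooth_in_line3 sA Uz).
  - move=> t p /andP[et tt1] _.
    have Uz : U (e, t, p) by apply: hU => //; exact: ltW.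
    have a0 : A (e, t, p) != 0 by apply: hA => //; exact: ltW.
    apply: (@density_derivative_le_flux_derivative _ _ _ (mu (e, t, p))).
    + exact: d0.
    + exact: a0.
    + by apply: hYA => //; exact: ltW.
    + have yad := is_derive_dot (smooth_in_line3 sY Uz) (smooth_in_line3 sA Uz).
      apply: (derive_right_eq0 yad ltr01) => q _.
      by apply: hYA => //; exact: ltW.
    + by apply: hT => //; exact: ltW.
    (* The linearized equation at [(e, t, p)]: all derivatives become derivatives in [eps], and the
       flow equation is differentiated from the right over [[e, t]], which is nondegenerate as
       [e < t]. *)
    + rewrite -TeE// -BeE// -AeE//.
      have r0 : 0 < t - e by rewrite subr_gt0.
      apply: (@dot_deriveE _ _ (fun s => Y (s, t, p)) (fun s => A (s, t, p))
        (fun s => B (s, t, p)) (fun s => T (s, t, p)) (fun s => mu (s, t, p))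
        e (t - e)); [exact: r0|exact: a0| | | | | |].
      * exact: (smooth_in_line1 sY Uz).
      * exact: (smooth_in_line1 sA Uz).
      * exact: (smooth_in_line1 sB Uz).
      * exact: (smooth_in_line1 sT Uz).
      * by rewrite addrC subrK => s /andP[es st]; apply: hYA => //; exact: ltW.
      * by rewrite addrC subrK => s /andP[es st]; apply: hT => //; exact: ltW.
  (* Periodicity of the flux. It passes from [f] to its derivatives by uniqueness of one-sided
     derivatives: in [eps] over [[e, t]], in [t] over [[t, t1]], and in [p] over a unit segment. *)
  - move=> t /andP[et tt1].
    have Ut p : U (e, t, p) by apply: hU => //; exact: ltW.
    have shift (W : normedModType R) (g : R -> W) (p : R) dg :
        is_derive (p + 1) 1 g dg -> is_derive p 1 (fun q => g (q + 1)) dg.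
      move=> gd; apply: (@is_derive_affine _ _ _ g (fun q => q + 1) 1) gd.
      by move=> h q; rewrite [h *: 1]mulr1 addrA.
    have AE p : A (e, t, p + 1) = A (e, t, p).
      apply: (derive_right_eq (shift _ _ _ _ (smooth_in_line3 sf (Ut (p + 1))))
        (smooth_in_line3 sf (Ut p)) ltr01) => q _.
      by apply: hper => //; exact: ltW.
    have YE p : Y (e, t, p + 1) = Y (e, t, p).
      apply: (@derive_right_eq _ _ _ _ e (t - e) _ _ (smooth_in_line1 sf (Ut (p + 1)))
        (smooth_in_line1 sf (Ut p))); rewrite ?subr_gt0// => q.
      by rewrite addrC subrK => /andP[eq qt]; apply: hper => //; exact: ltW.
    have TE p : T (e, t, p + 1) = T (e, t, p).
      apply: (@derive_right_eq _ _ _ _ t (t1 - t) _ _ (smooth_in_line2 sf (Ut (p + 1)))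
        (smooth_in_line2 sf (Ut p))); rewrite ?subr_gt0// => q.
      rewrite addrC subrK => /andP[tq qt1]; apply: hper => //.
      exact: le_trans (ltW et) tq.
    have YpE p : Yp (e, t, p + 1) = Yp (e, t, p).
      apply: (derive_right_eq (shift _ _ _ _ (smooth_in_line3 sY (Ut (p + 1))))
        (smooth_in_line3 sY (Ut p)) ltr01) => q _.
      exact: YE.
    by rewrite /H -[X in (e, t, X)]add0r AE YE TE YpE.
have cont (g : R * R * R -> 'rV[R]_n) t p : smooth_in U g -> e <= t <= t1 ->
    {for p, continuous (fun q => g (e, t, q))}.
  move=> sg /andP[et tt1]; apply: differentiable_continuous.
  apply/derivable1_diffP.
  exact: (@ex_derive _ _ _ _ _ _ _ (smooth_in_line3 sg (hU _ _ p (lexx e) et tt1))).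
have ee : e <= e <= t1 by rewrite lexx.
have e1 : e <= t1 <= t1 by rewrite lexx et1.
have cI t p : e <= t <= t1 ->
    {for p, continuous (fun q => enorm (Y (e, t, q)) * enorm (A (e, t, q)))}.
  move=> h; apply: cvgM.
    exact: (continuous_enorm (cont _ _ _ sY h)).
  exact: (continuous_enorm (cont _ _ _ sA h)).
have cF d t p : e <= t <= t1 ->
    {for p, continuous (fun q => reg_norm d (Y (e, t, q)) * enorm (A (e, t, q)))}.
  by move=> h; exact: (continuous_density (cont _ _ _ sY h) (cont _ _ _ sA h)).
have cL p : {for p, continuous (fun q => enorm (A (e, e, q)))}.
  exact: (continuous_enorm (cont _ _ _ sA ee)).
rewrite [leLHS](integral_segmentE (fun p _ => cI t1 p e1)).
rewrite [leRHS](integral_segmentE (fun p _ => cI e p ee)).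
rewrite lee_fin; apply/ler_addgt0Pr => r r0.
pose L := \int[@lebesgue_measure R]_(p in `[0%R, 1%R]) enorm (A (e, e, p)).
have L0 : 0 <= L by apply: Rintegral_ge0 => p _; exact: sqrtr_ge0.
have L1 : 0 < L + 1 by rewrite ltr_wpDl.
(* Regularizing with [d = k^2] costs at most [k L] at the initial time, where [L] is the length of
   that curve, and this is below [r]. At the final time the regularized integral is already an upper
   bound. *)
pose k := r / (L + 1).
have k0 : 0 < k by rewrite divr_gt0.
have k2 : 0 < k ^+ 2 by rewrite exprn_gt0.
apply: (@le_trans _ _ (\int[@lebesgue_measure R]_(p in `[0%R, 1%R])
    (reg_norm (k ^+ 2) (Y (e, t1, p)) * enorm (A (e, t1, p))))).
  apply: le_Rintegral.
  - by [].
  - by apply: integrable_segment => p _; exact: cI.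
  - by apply: integrable_segment => p _; exact: cF.
  - by move=> p _; apply: ler_wpM2r; [exact: sqrtr_ge0|exact: reg_norm_ge].
apply: le_trans (main _ k2) _.
apply: (@le_trans _ _ (\int[@lebesgue_measure R]_(p in `[0%R, 1%R])
    (enorm (Y (e, e, p)) * enorm (A (e, e, p)) + k * enorm (A (e, e, p))))).
  apply: le_Rintegral.
  - by [].
  - by apply: integrable_segment => p _; exact: cF.
  - apply: integrable_segment => p _; apply: cvgD; first exact: cI.
    by apply: cvgM; [exact: cvg_cst|exact: cL].
  - move=> p _; rewrite -mulrDl; apply: ler_wpM2r; first exact: sqrtr_ge0.
    exact: reg_norm_le.
rewrite RintegralD; first last.
- by apply: integrable_segment => p _; apply: cvgM; [exact: cvg_cst|exact: cL].
- by apply: integrable_segment => p _; exact: cI.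
- by [].
rewrite lerD2l RintegralZl; first last.
- by apply: integrable_segment => p _; exact: cL.
- by [].
by rewrite -/L /k mulrAC ler_pdivrMr// ler_pM2l// lerDl ler01.
Qed.

(** * The diagonal and the conclusion *)

Lemma derive_left_eq (R : realType) (V : normedModType R) (f g : R -> V)
    (x r : R) df dg : is_derive x 1 f df -> is_derive x 1 g dg -> 0 < r ->
  (forall y, x - r <= y <= x -> f y = g y) -> df = dg.
Proof.
move=> fd gd r0 fg; apply/eqP; rewrite -subr_eq0; apply/eqP.
apply: (derive_left_eq0 (is_deriveB fd gd) r0) => y xy.
by rewrite fctE fg// subrr.
Qed.

(** At [x < b] one compares from the right, at [x = b] from the left; [a < b] guarantees that one
    side is available. The endpoint [b] matters because the diagonal ends at [t1]. *)
Lemma eq_on_segment_derive (R : realType) (V : normedModType R) (f g : R -> V)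
    (a b x : R) df dg : a < b -> a <= x <= b ->
  is_derive x 1 f df -> is_derive x 1 g dg ->
  (forall y, a <= y <= b -> f y = g y) -> df = dg.
Proof.
move=> ab /andP[ax xb] fd gd fg; have [xb'|bx] := ltP x b.
  apply: (@derive_right_eq _ _ f g x (b - x)) => //; first by rewrite subr_gt0.
  by move=> y /andP[xy]; rewrite addrC subrK => yb; apply: fg; rewrite yb (le_trans ax).
apply: (@derive_left_eq _ _ f g x (x - a)) => //.
  by rewrite subr_gt0; exact: lt_le_trans ab bx.
by move=> y; rewrite subKr => /andP[ay yx]; apply: fg; rewrite ay (le_trans yx).
Qed.

Lemma periodic_shift_int (R : realType) (T : Type) (f : R -> T) (m : int) p :
  (forall p, f (p + 1) = f p) -> f (p + m%:~R) = f p.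
Proof.
move=> f1; have fn (k : nat) q : f (q + k%:R) = f q.
  elim: k q => [|k ih] q; first by rewrite addr0.
  by rewrite -natr1 addrA f1.
case: m => k; first exact: fn.
by rewrite NegzE mulrNz -(fn k.+1 (p - _)) subrK.
Qed.

(** Subtracting the floor of [p] moves [p] into [[0, 1]]. Equality on the whole line is what makes
    derivatives in [p] agree at the endpoints of the period too. *)
Lemma periodic_eq (R : realType) (T : Type) (f g : R -> T) :
  (forall p, f (p + 1) = f p) -> (forall p, g (p + 1) = g p) ->
  (forall p, 0 <= p <= 1 -> f p = g p) -> f = g.
Proof.
move=> f1 g1 fg; apply/funext => p.
rewrite -(periodic_shift_int (- Num.floor p) p f1).
rewrite -(periodic_shift_int (- Num.floor p) p g1); apply: fg.
rewrite mulrNz subr_ge0 floor_le/= lerBlDl.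
by rewrite -[X in _ + X]/(1%:~R) -intrD ltW// floorD1_gt.
Qed.

Lemma dot_dds_self (R : realType) n (c : R -> 'rV[R]_n) p :
  derive1 c p != 0 -> dot (dds c c p) (dds c c p) = 1.
Proof.
move=> a0; have v0 := enorm_gt0 a0.
rewrite /dds dotZl dotZr -enorm_sqr /speed; field.
by rewrite gt_eqF.
Qed.

Lemma dot_dds_dds (R : realType) n (c : R -> 'rV[R]_n) p b :
  derive1 c p != 0 -> is_derive p 1 (derive1 c) b ->
  dot (dds c (dds c c) p) (dds c c p) = 0.
Proof.
move=> a0 ad; rewrite (dds_ddsE a0 ad) /dds.
rewrite dotZr dotDl dotNl !dotZl (dotC b).
have q0 : dot (derive1 c p) (derive1 c p) != 0 by rewrite gt_eqF// dot_gt0.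
have -> : forall q s : R, q != 0 -> q^-1 * s - s / q ^+ 2 * q = 0.
- by move=> q s q_neq0; field.
- by rewrite mulr0.
- exact: q0.
Qed.

(** Read with [k] the curvature vector: the normal projection keeps [y] and [k], both orthogonal to
    the unit tangent, and removes the tangential motion [l]. *)
Lemma normal_part_flow (R : realType) n (c : R -> 'rV[R]_n) p (y k : 'rV[R]_n) l :
  dot (dds c c p) (dds c c p) = 1 -> dot y (dds c c p) = 0 ->
  dot k (dds c c p) = 0 ->
  normal_part c p (y + (k + l *: dds c c p)) - k = y.
Proof.
move=> u1 yu ku; rewrite /normal_part !dotDl dotZl u1 yu ku !add0r mulr1.
by rewrite addrA addrK addrK.
Qed.

Theorem mainTheorem3 (R : realType) (n : nat) (t0 t1 : R)
    (X0 X1 : R -> R -> 'rV[R]_n) (X : R -> R -> R -> 'rV[R]_n)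
    (t01 : t0 <= t1)
    (X0_moving : moving_closed_curve t0 t1 X0)
    (X1_solution : curve_shortening_solution t0 t1 X1)
    (X01_initial : forall p : R, 0 <= p <= 1 -> X0 t0 p = X1 t0 p)
    (X_smooth : smooth_on (prism t0 t1)
       (fun z : R * R * R => X z.1.1 z.1.2 z.2))
    (X_solution : forall eps : R, t0 <= eps <= t1 ->
       curve_shortening_solution eps t1 (X eps))
    (X_initial : forall eps p : R, t0 <= eps <= t1 -> 0 <= p <= 1 ->
       X eps eps p = X0 eps p)
    (X_orthogonal : forall eps t p : R, t0 <= eps -> eps <= t -> t <= t1 ->
       dot (derive1 (fun e => X e t p) eps) (derive1 (X eps t) p) = 0) :
  (\int[lebesgue_measure]_(eps in `[t0, t1])
      arclength_integral (X eps t1)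
        (fun p => enorm (derive1 (fun e => X e t1 p) eps))
   <=
   \int[lebesgue_measure]_(t in `[t0, t1])
      arclength_integral (X0 t)
        (fun p => enorm (normal_part (X0 t) p (derive1 (X0 ^~ p) t)
                         - dds (X0 t) (dds (X0 t) (X0 t)) p)%R))%E.
Proof.
have arc_ge0 (c : R -> 'rV[R]_n) (w : R -> 'rV[R]_n) :
    (0 <= arclength_integral c (fun p => enorm (w p)))%E.
  by apply: integral_ge0 => p _; rewrite lee_fin mulr_ge0// sqrtr_ge0.
(* If [t0 = t1], the outer integral on the left is over a point and vanishes. Otherwise the time
   interval is nondegenerate, as the comparison of derivatives on the diagonal requires. *)
rewrite le_eqVlt in t01; case/orP: t01 => [/eqP <-|t01].
  rewrite set_itv1 [leLHS]integral_set1.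
  by apply: integral_ge0 => t _; exact: arc_ge0.
pose f (z : R * R * R) := X z.1.1 z.1.2 z.2.
have [U [oU pU sf]] := X_smooth.
have {X_smooth pU} hU s t p : t0 <= s -> s <= t -> t <= t1 -> U (s, t, p).
  by move=> ? ? ?; apply: pU.
pose Y := 'D_(basis1 R) f; pose A := 'D_(basis3 R) f; pose T := 'D_(basis2 R) f.
have sA : smooth_in U A by exact: smooth_in_derive.
have YE e t p : derive1 (fun s => X s t p) e = Y (e, t, p).
  exact: (derive1_line1 f).
have AE e t : derive1 (X e t) = fun p => A (e, t, p).
  by apply/funext => p; exact: (derive1_line3 f).
have TE e t p : derive1 (X e ^~ p) t = T (e, t, p).
  exact: (derive1_line2 f).
have Ad e t p : U (e, t, p) -> is_derive p 1 (derive1 (X e t)) ('D_(basis3 R) A (e, t, p)).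
  by move=> Uz; rewrite AE; exact: smooth_in_line3 sA Uz.
apply: ge0_le_integral_nonmeasurable => e; first by move=> _; exact: arc_ge0.
rewrite /= in_itv /= => /andP[t0e et1].
have eI : t0 <= e <= t1 by rewrite t0e.
have [[_ X_per X_reg] [l [_ _ X_cs]]] := X_solution e eI.
have ee : e <= e <= t1 by rewrite lexx.
have Aee p : derive1 (X e e) p != 0 by exact: X_reg.
have X0E s : t0 <= s <= t1 -> X0 s = X s s.
  move=> sI; have [_ X0_per _] := X0_moving.
  have [[_ Xs_per _] _] := X_solution s sI.
  have ss : s <= s <= t1 by rewrite lexx; case/andP: sI.
  by apply: periodic_eq => p; [exact: X0_per|exact: Xs_per|move=> ?; rewrite X_initial].
have X0t p : derive1 (X0 ^~ p) e = Y (e, e, p) + T (e, e, p).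
  have [[U0 [oU0 pU0 sf0]] _ _] := X0_moving.
  pose f0 (z : R * R) := X0 z.1 z.2; pose v0 : R * R := (1, 0).
  have d0 : is_derive e 1 (X0 ^~ p) (derive1 (X0 ^~ p) e).
    have lE h s : (h + s, p) = h *: v0 + (s, p).
      rewrite (_ : _ + _ = (h *: 1 + s, h *: 0 + p))//.
      by rewrite [h *: 1]mulr1 scaler0 add0r.
    have -> : derive1 (X0 ^~ p) e = 'D_v0 f0 (e, p).
      exact: (@derive1_affine _ _ _ f0 (fun s => (s, p)) v0 e lE).
    apply: (@is_derive_affine _ _ _ f0 (fun s => (s, p)) v0 e _ lE).
    apply: (smooth_in_is_derive v0 (U := U0)); first exact: sf0.
    exact: pU0.
  have Ue : U (e, e, p) by exact: hU.
  (* Chain rule on the diagonal: moving [s] in [(s, s, p)] is motion in direction [basis1 + basis2],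
     and the differential is linear in the direction. *)
  have d1 : is_derive e 1 (fun s => f (s, s, p)) (Y (e, e, p) + T (e, e, p)).
    have df : differentiable f (e, e, p) by exact: (sf [::]).
    apply: (@is_derive_affine _ _ _ f (fun s => (s, s, p)) (basis1 R + basis2 R)).
      move=> h s; rewrite scalerDr -addrA -line2E -line1E//.
    have -> : Y (e, e, p) + T (e, e, p) = 'D_(basis1 R + basis2 R) f (e, e, p).
      by rewrite /Y /T !deriveE// linearD.
    exact: smooth_in_is_derive sf Ue.
  apply: (eq_on_segment_derive t01 eI d0 d1) => s sI.
  by rewrite X0E.
(* The integrand of [Delta] at time [e] is thus the norm of [X_eps] on the diagonal, so the
   contraction applies with the same [e] on both sides. *)
have -> : arclength_integral (X0 e)
    (fun p => enorm (normal_part (X0 e) p (derive1 (X0 ^~ p) e)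
                     - dds (X0 e) (dds (X0 e) (X0 e)) p))
  = arclength_integral (X e e) (fun p => enorm (Y (e, e, p))).
  rewrite (X0E e eI); congr arclength_integral; apply/funext => p.
  congr enorm; rewrite X0t -TE X_cs//; apply: normal_part_flow.
  - exact: dot_dds_self.
  - by rewrite /dds dotZr -YE X_orthogonal// mulr0.
  - by apply: dot_dds_dds (Aee p) (Ad _ _ _ _); exact: hU.
rewrite [Z in arclength_integral (X e t1) Z](_ : _ = fun p => enorm (Y (e, t1, p)));
  last by apply/funext => p; rewrite YE.
rewrite /arclength_integral /speed !AE.
apply: (@flow_contraction _ _ _ f e t1 oU sf et1) => s t p es st tt1.
have t0s : t0 <= s by exact: le_trans es.
have sI : t0 <= s <= t1 by rewrite t0s (le_trans st).
have Uz : U (s, t, p) by exact: hU.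
have stI : s <= t <= t1 by rewrite st.
have [[_ Xs_per Xs_reg] [ls [_ _ Xs_cs]]] := X_solution s sI.
have a0 := Xs_reg t p stI.
have aE : derive1 (X s t) p = A (s, t, p) by rewrite AE.
have a0' : A (s, t, p) != 0 by rewrite -aE.
have ya : dot (Y (s, t, p)) (A (s, t, p)) = 0.
  by rewrite -YE -aE; exact: X_orthogonal.
(* Both the tangential part of the curvature formula and the reparametrization term [ls] are
   multiples of [X_p]; [m] is the sum of their coefficients. *)
have [m mE] : exists m, T (s, t, p)
    = (dot (A (s, t, p)) (A (s, t, p)))^-1 *: 'D_(basis3 R) A (s, t, p)
      + m *: A (s, t, p).
  have := TE s t p; rewrite (Xs_cs t p stI) (dds_ddsE a0 (Ad _ _ _ Uz)) /dds aE.
  rewrite scalerA -addrA -scaleNr -scalerDl => <-.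
  by eexists.
split; [exact: Uz|exact: a0'|exact: ya|exact: Xs_per|].
by exists m; exact: mE.
Qed.
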